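(* Let $n$ be a positive integer, and let $c:E(K_{6n})\to [3]$ be an edge-coloring (not necessarily proper) of the complete graph $K_{6n}$ on $6n$ vertices such that, for every $i\in[3]$, there are equally many edges $e$ with $c(e)=i$. Then there is a perfect matching $M$ of $K_{6n}$ with $$f(M)=\sum_{i=1}^3\Big||c^{-1}(i)\cap M|-n\Big|\leq 2.$$
   Context: $[3]=\{1,2,3\}$. For a perfect matching $M$, $|c^{-1}(i)\cap M|$ is the number of edges of $M$ with color $i$. *)

(* Defs.v *)
From mathcomp Require Import all_boot all_order all_algebra.

Set Implicit Arguments.
Unset Strict Implicit.
Unset Printing Implicit Defensive.

Import GRing.Theory Num.Theory.

Local Open Scope ring_scope.

Definition complete_edges (V : finType) : {set {set V}} :=
  [set e : {set V} | #|e| == 2%N].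

(* A colouring is a total function on {set V}; only its values on
   two-element sets are ever used. The colours 1, 2, 3 are the elements
   of 'I_3. *)
Definition color_class (V : finType) (c : {set V} -> 'I_3) (i : 'I_3) :
    {set {set V}} :=
  [set e in complete_edges V | c e == i].

Definition perfect_matching (V : finType) (M : {set {set V}}) : bool :=
  (M \subset complete_edges V) && partition M [set: V].

Definition matching_deviation (n : nat) (c : {set 'I_(6 * n)} -> 'I_3)
    (M : {set {set 'I_(6 * n)}}) : int :=
  \sum_(i < 3) (`|#|color_class c i :&: M|%:Z - n%:Z| : int).

(* Main.v *)
Require Import Defs.
From mathcomp Require Import all_boot all_order all_algebra all_fingroup.
From mathcomp Require Import zify ring lra.

(* Write d(M) for the vector of deviations |c^-1(i) :&: M| - n and t for the
   minimum over all perfect matchings of max_i |d_i(M)|; assume t >= 2.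
   Replacing the edges u u', v v' of M by u v, u' v' changes d(M) by a vector
   of maximum norm at most 2.  Every edge outside M arises from exactly one
   such switch, so the sum of these changes over all switches of M is a
   negative multiple of d(M): for every linear form that is positive at d(M)
   some switch decreases it.  Together with the minimality of t this yields a
   matching M with d(M) = (t, 1-t, -1) and a switch changing d(M) by
   (-1, -1, 2), up to a permutation of the colours, leading to M' with
   d(M') = (t-1, -t, 1).  A switch that avoids the four vertices involved is
   available in both M and M', and minimality of t at both places forbids it
   from decreasing d_1 - d_2.  The O(n) remaining switches cannot account for
   the decrease of d_1 - d_2 that is required at M. *)

Set Implicit Arguments.
Unset Strict Implicit.
Unset Printing Implicit Defensive.
Import Order.TTheory GRing.Theory Num.Theory.
Local Open Scope ring_scope.

(** * Perfect matchings as involutions, and switches *)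

(* A perfect matching is encoded as a fixpoint-free involution. *)
Definition pairing (V : finType) (m : {perm V}) : bool :=
  [forall x, (m (m x) == x) && (m x != x)].

Definition pairing_edges (V : finType) (m : {perm V}) : {set {set V}} :=
  [set [set x; m x] | x : V].

(* Conjugating by the transposition of m u and v replaces the edges {u, m u}
   and {v, m v} by {u, v} and {m u, m v}. *)
Definition switch (V : finType) (m : {perm V}) (u v : V) : {perm V} :=
  (m ^ tperm (m u) v)%g.

Definition switchable (V : finType) (m : {perm V}) (u v : V) : bool :=
  (v != u) && (v != m u).

Lemma pairingK (V : finType) (m : {perm V}) : pairing m -> involutive m.
Proof. by move=> /forallP pm x; case/andP: (pm x) => /eqP. Qed.

Lemma pairing_neq (V : finType) (m : {perm V}) x : pairing m -> m x != x.
Proof. by move=> /forallP pm; case/andP: (pm x). Qed.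

Lemma pairing_conj (V : finType) (m s : {perm V}) :
  pairing m -> pairing (m ^ s)%g.
Proof.
move=> pm; apply/forallP=> x; rewrite -[x](permKV s) !permJ.
by rewrite pairingK // eqxx (inj_eq perm_inj) pairing_neq.
Qed.

Lemma switch_id (V : finType) (m : {perm V}) u v x :
  pairing m -> x \notin [:: u; m u; v; m v] -> switch m u v x = m x.
Proof.
move=> pm; rewrite !inE !negb_or => /and4P[xu xmu xv xmv].
have -> : x = tperm (m u) v x by rewrite tpermD // eq_sym.
rewrite permJ !tpermD //; last 4 first.
- by rewrite eq_sym.
- by rewrite eq_sym.
- by rewrite (inj_eq perm_inj) eq_sym.
by rewrite -(pairingK pm v) (inj_eq perm_inj) eq_sym.
Qed.

Lemma switch_l (V : finType) (m : {perm V}) u v :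
  pairing m -> switchable m u v -> switch m u v u = v.
Proof.
move=> pm /andP[vu vmu].
have {2}-> : u = tperm (m u) v u by rewrite tpermD // pairing_neq.
by rewrite permJ tpermL.
Qed.

(** Both switches conjugate by the same transposition of [m u] and [v], so every switch can be
    undone by a switch. *)
Lemma switchK (V : finType) (m : {perm V}) u v :
  pairing m -> switchable m u v -> switch (switch m u v) u (m u) = m.
Proof.
move=> pm suv; rewrite {1}/switch switch_l // tpermC /switch.
by rewrite -conjgM tperm2 conjg1.
Qed.

Lemma switchableK (V : finType) (m : {perm V}) u v :
  pairing m -> switchable m u v -> switchable (switch m u v) u (m u).
Proof.
move=> pm suv; rewrite /switchable switch_l // pairing_neq //=.
by case/andP: suv => _; rewrite eq_sym.
Qed.

(** * Symmetric edge weights summed along a pairing and over all its switches *)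

(** After reindexing by the transposition only the terms at [u], [m u], [v], [m v] differ; the
    factor 2 appears because each edge is met from both of its ends. *)
Lemma sum_switch (V : finType) (w : V -> V -> int) (m : {perm V}) u v :
    (forall x y, w x y = w y x) -> pairing m -> switchable m u v ->
  \sum_x w x (switch m u v x) =
  \sum_x w x (m x) + 2 * (w u v + w (m u) (m v) - w u (m u) - w v (m v)).
Proof.
move=> wC pm /andP[vu vmu]; have mK := pairingK pm.
have mN x : m x != x by apply: pairing_neq.
rewrite (reindex_inj (@perm_inj _ (tperm (m u) v))) /=.
under eq_bigr do rewrite permJ.
have muv : m v != u by rewrite -(inj_eq (@perm_inj _ m)) mK.
have mvu : m v != m u by rewrite (inj_eq perm_inj).
rewrite (bigD1 u) // (bigD1 (m u)) //= (bigD1 v) ?vu //= (bigD1 (m v)) ?muv ?mvu ?mN //=.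
rewrite [in RHS](bigD1 u) // [in RHS](bigD1 (m u)) //= [in RHS](bigD1 v) ?vu //=.
rewrite [in RHS](bigD1 (m v)) ?muv ?mvu ?mN //= !mK.
rewrite tpermL tpermR [tperm _ _ u]tpermD ?mN // [tperm _ _ (m v)]tpermD 1?eq_sym //.
rewrite (eq_bigr (fun x => w x (m x))); last first.
  move=> x /andP[/andP[/andP[xu xmu] xv] xmv].
  rewrite !tpermD // 1?eq_sym //; first by rewrite (inj_eq perm_inj).
  by rewrite -(inj_eq (@perm_inj _ m)) mK.
rewrite (wC v u) (wC (m v) (m u)) (wC (m u) u) (wC (m v) v).
ring.
Qed.

Lemma sum_switchable (V : finType) (F : V -> int) (m : {perm V}) u :
  pairing m -> \sum_(v | switchable m u v) F v = \sum_(v | v != u) F v - F (m u).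
Proof.
by move=> pm; rewrite (bigD1 (m u) (pairing_neq u pm)) /= addrAC subrr add0r.
Qed.

(* The factor 2 on the right: each edge outside m lies in exactly one switch,
   which is parametrised by four ordered pairs (u, v). *)
Lemma sum_switch_all (V : finType) (w : V -> V -> int) (m : {perm V}) :
    (forall x y, w x y = w y x) -> pairing m ->
  \sum_u \sum_(v | switchable m u v)
     (w u v + w (m u) (m v) - w u (m u) - w v (m v)) =
  2 * (\sum_u \sum_(v | v != u) w u v) -
  2 * (#|V|%:Z - 1) * \sum_x w x (m x).
Proof.
move=> wC pm; have mK := pairingK pm.
pose S := \sum_x w x (m x); pose W := \sum_u \sum_(v | v != u) w u v.
(* Each of the four sums loses its term at [v = m u]; by symmetry of [w] these lost terms cancel. *)
under eq_bigr => u _ do rewrite !sumrB big_split /= !sum_switchable // mK.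
rewrite !sumrB big_split /= !sumrB.
have -> : \sum_u \sum_(v | v != u) w (m u) (m v) = W.
  rewrite /W [RHS](reindex_inj (@perm_inj _ m)); apply: eq_bigr => u _.
  rewrite [RHS](reindex_inj (@perm_inj _ m)); apply: eq_bigl => v.
  by rewrite (inj_eq perm_inj).
have cst x : \sum_(v | v != x) w x (m x) = (#|V|%:Z - 1) * w x (m x).
  have h : \sum_(v : V) w x (m x) = #|V|%:Z * w x (m x).
    by rewrite sumr_const -mulr_natl natz.
  by rewrite mulrBl mul1r -h [in RHS](bigD1 x) //= addrAC subrr add0r.
have -> : \sum_u \sum_(v | v != u) w u (m u) = (#|V|%:Z - 1) * S.
  by rewrite /S mulr_sumr; apply: eq_bigr => u _; rewrite cst.
have -> : \sum_u \sum_(v | v != u) w v (m v) = (#|V|%:Z - 1) * S.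
  rewrite (exchange_big_dep predT) //= /S mulr_sumr; apply: eq_bigr => u _.
  by rewrite -cst; apply: eq_bigl => v; rewrite eq_sym.
have -> : \sum_x w (m x) x = S by apply: eq_bigr => x _; rewrite wC.
rewrite -/S -/W; ring.
Qed.

(** * Handshake counting and the passage back to edge sets *)

(** For fixed [u], the map from [v] to [[set u; v]] is a bijection onto the edges of [C] at [u];
    each edge is then counted at its two ends. *)
Lemma sum_degree2 (V : finType) (C : {set {set V}}) :
    C \subset complete_edges V ->
  \sum_u \sum_(v | v != u) ([set u; v] \in C)%:Z = 2 * #|C|%:Z.
Proof.
move=> /subsetP sC.
have sum_in (T : finType) (A : {set T}) (P : pred T) :
    \sum_(x | P x) (x \in A)%:Z = #|[set x in A | P x]|%:Z.
  rewrite -sum1_card -natz natr_sum big_mkcond [RHS]big_mkcond /=.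
  by apply: eq_bigr => x _; rewrite !inE andbC; case: (P x) (x \in A) => [] [].
have deg u : \sum_(v | v != u) ([set u; v] \in C)%:Z = \sum_(e in C) (u \in e)%:Z.
  rewrite (_ : \sum_(e in C) _ = #|[set e in C | u \in e]|%:Z); last first.
    rewrite -sum_in big_mkcond [RHS]big_mkcond /=.
    by apply: eq_bigr => e _; case: (_ \in C) (u \in e) => [] [].
  rewrite (eq_bigr (fun v => (v \in [set v | [set u; v] \in C])%:Z)); last first.
    by move=> v _; rewrite inE.
  rewrite sum_in; set D := [set x in _ | _].
  have -> : [set e in C | u \in e] = [set [set u; v] | v in D].
    apply/setP=> e; rewrite inE; apply/andP/imsetP => [[eC ue]|[v]].
      have : #|e :\ u| == 1%N.
        by have := sC e eC; rewrite inE (cardsD1 u e) ue.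
      case/cards1P => v ev; exists v; last by rewrite -ev setD1K.
      have : v \in e :\ u by rewrite ev set11.
      by rewrite !inE -ev setD1K // eC => /andP[->].
    by rewrite !inE => /andP[vC vu] ->; rewrite vC !inE eqxx.
  rewrite card_in_imset // => v w; rewrite !inE => /andP[_ vu] _ /setP/(_ v).
  by rewrite !inE eqxx orbT (negPf vu) => /esym/eqP.
under eq_bigr do rewrite deg.
rewrite exchange_big /= (eq_bigr (fun=> 2%:Z)); last first.
  move=> e /sC; rewrite inE => /eqP <-.
  by rewrite -sum1_card -natz natr_sum big_mkcond [RHS]big_mkcond /=; apply: eq_bigr => x _; case: (x \in e).
by rewrite sumr_const -[LHS]mulr_natr natz.
Qed.

Lemma card_color_class_sum (V : finType) (c : {set V} -> 'I_3) i :
  \sum_u \sum_(v | v != u) (c [set u; v] == i)%:Z = 2 * #|color_class c i|%:Z.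
Proof.
rewrite -sum_degree2; last by apply/subsetP => e; rewrite inE => /andP[].
apply: eq_bigr => u _; apply: eq_bigr => v vu.
by rewrite !inE cards2 [u == v]eq_sym vu.
Qed.

Lemma mem_pairing_edges (V : finType) (m : {perm V}) u v :
  pairing m -> ([set u; v] \in pairing_edges m) = (v == m u).
Proof.
move=> pm; apply/imsetP/eqP => [[x _ e]|->]; last by exists u.
have xuv : x \in [set u; v] by rewrite e set21.
have mxuv : m x \in [set u; v] by rewrite e set22.
have xNm := negPf (pairing_neq x pm).
have : u \in [set x; m x] by rewrite -e set21.
rewrite !inE => /orP[]/eqP eu; move: xuv mxuv; rewrite !inE eu.
  by rewrite xNm => _ /eqP->.
by rewrite [x == m x]eq_sym xNm pairingK // => /eqP->.
Qed.

Lemma card_color_pairing_sum (V : finType) (c : {set V} -> 'I_3) m i :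
    pairing m ->
  \sum_u (c [set u; m u] == i)%:Z =
  2 * #|color_class c i :&: pairing_edges m|%:Z.
Proof.
move=> pm; rewrite -sum_degree2; last first.
  by apply/subsetP => e; rewrite !inE => /andP[/andP[]].
apply: eq_bigr => u _; rewrite (bigD1 (m u)) ?pairing_neq //=.
rewrite big1 ?addr0 => [|v /andP[_ vmu]].
  by rewrite !inE cards2 [u == _]eq_sym pairing_neq // mem_pairing_edges // eqxx andbT.
by rewrite inE mem_pairing_edges // (negPf vmu) andbF.
Qed.

Lemma perfect_matching_pairing (V : finType) (m : {perm V}) :
  pairing m -> perfect_matching (pairing_edges m).
Proof.
move=> pm; apply/andP; split.
  apply/subsetP => e /imsetP[x _ ->].
  by rewrite inE cards2 [x == _]eq_sym pairing_neq.
apply/and3P; split.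
- rewrite eqEsubset subsetT; apply/subsetP => x _; apply/bigcupP.
  by exists [set x; m x]; [apply: imset_f | rewrite set21].
- apply/trivIsetP => _ _ /imsetP[x _ ->] /imsetP[y _ ->].
  apply: contraR => /pred0Pn[z /=]; rewrite !inE.
  have mK := pairingK pm.
  by case/andP => /orP[]/eqP-> /orP[]/eqP => [->|->|<-|/perm_inj->] //;
    rewrite ?mK // setUC.
- apply/imsetP => -[x _ /setP/(_ x)].
  by rewrite !inE eqxx.
Qed.

(** * Deviations, gains and the averaging argument *)

Definition deviation (V : finType) (n : nat) (c : {set V} -> 'I_3)
    (m : {perm V}) (i : 'I_3) : int :=
  #|color_class c i :&: pairing_edges m|%:Z - n%:Z.

Definition gain (V : finType) (c : {set V} -> 'I_3) (m : {perm V}) (u v : V)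
    (i : 'I_3) : int :=
  (c [set u; v] == i)%:Z + (c [set m u; m v] == i)%:Z
  - (c [set u; m u] == i)%:Z - (c [set v; m v] == i)%:Z.

Lemma color_eqC (V : finType) (c : {set V} -> 'I_3) (i : 'I_3) u v :
  (c [set u; v] == i)%:Z = (c [set v; u] == i)%:Z.
Proof. by rewrite setUC. Qed.

Lemma ind_color (i j k : 'I_3) : uniq [:: i; j; k] -> forall x : 'I_3,
  [/\ 0 <= (x == i)%:Z, 0 <= (x == j)%:Z, 0 <= (x == k)%:Z
    & (x == i)%:Z + (x == j)%:Z + (x == k)%:Z = 1].
Proof.
move=> h x; split=> //.
by case: i j k x h => [[|[|[]]] //] ? [[|[|[]]] //] ? [[|[|[]]] //] ? [[|[|[]]] //] ?.
Qed.

Lemma deviation_switch (V : finType) n (c : {set V} -> 'I_3) m u v i :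
    pairing m -> switchable m u v ->
  deviation n c (switch m u v) i = deviation n c m i + gain c m u v i.
Proof.
move=> pm suv.
have := sum_switch (color_eqC c i) pm suv.
rewrite !card_color_pairing_sum ?pairing_conj // /deviation /gain.
lia.
Qed.

Lemma sum_deviation (n : nat) (c : {set 'I_(6 * n)} -> 'I_3) m i j k :
    uniq [:: i; j; k] -> pairing m ->
  deviation n c m i + deviation n c m j + deviation n c m k = 0.
Proof.
move=> ijk pm.
have : \sum_u (c [set u; m u] == i)%:Z + \sum_u (c [set u; m u] == j)%:Z +
    \sum_u (c [set u; m u] == k)%:Z = (6 * n)%:Z.
  rewrite -!big_split /= (eq_bigr (fun=> 1)) => [|u _]; last first.
    by case: (ind_color ijk (c [set u; m u])).
  by rewrite sumr_const card_ord natz.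
rewrite !card_color_pairing_sum // /deviation; lia.
Qed.

(** The three colours share the 3n(6n - 1) edges equally; the proof counts ordered pairs of distinct
    vertices. *)
Lemma card_color_class_balanced (n : nat) (c : {set 'I_(6 * n)} -> 'I_3) i :
    (forall i j, #|color_class c i| = #|color_class c j|) ->
  #|color_class c i|%:Z = n%:Z * (6 * n%:Z - 1).
Proof.
move=> bal.
have [j [k ijk]] : exists j k, uniq [:: i; j; k].
  by case: i => [[|[|[]]] // ?]; [exists (inord 1), (inord 2)
    | exists (inord 0), (inord 2) | exists (inord 0), (inord 1)];
    rewrite /= !inE -!val_eqE /= !inordK.
have cst (V : finType) (u : V) : \sum_(v | v != u) (1 : int) = #|V|%:Z - 1.
  have : \sum_(v : V) (1 : int) = #|V|%:Z by rewrite sumr_const natz.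
  by rewrite (bigD1 u) //= => <-; rewrite addrAC subrr add0r.
have tot : \sum_u \sum_(v | v != u) (c [set u; v] == i)%:Z +
    \sum_u \sum_(v | v != u) (c [set u; v] == j)%:Z +
    \sum_u \sum_(v | v != u) (c [set u; v] == k)%:Z
    = (6 * n)%:Z * ((6 * n)%:Z - 1).
  rewrite -!big_split /= (eq_bigr (fun=> (6 * n)%:Z - 1)) => [|u _].
    by rewrite sumr_const card_ord -mulr_natl natz.
  rewrite -!big_split /= -[in RHS](card_ord (6 * n)) -(cst _ u).
  by apply: eq_bigr => v _; case: (ind_color ijk (c [set u; v])).
move: tot; rewrite !card_color_class_sum (bal j i) (bal k i).
by move: #|_| => x; nia.
Qed.

(** With d the deviation, [sum_switch_all] gives 4n(6n - 1) - 4(6n - 1)(n + d), where balance makes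
    the terms free of d cancel. *)
Lemma sum_gain (n : nat) (c : {set 'I_(6 * n)} -> 'I_3) m i :
    (forall i j, #|color_class c i| = #|color_class c j|) -> pairing m ->
  \sum_u \sum_(v | switchable m u v) gain c m u v i =
  - (4 * (6 * n%:Z - 1)) * deviation n c m i.
Proof.
move=> bal pm; rewrite (sum_switch_all (color_eqC c i) pm).
rewrite card_color_class_sum card_color_pairing_sum // card_ord.
rewrite (card_color_class_balanced _ bal) /deviation.
rewrite (_ : (6 * n)%:Z = 6 * n%:Z); last by lia.
ring.
Qed.

(** Averaging: the form summed over all switches is a negative multiple of its value at the
    deviations, so some summand is negative. *)
Lemma exists_gain (n : nat) (c : {set 'I_(6 * n)} -> 'I_3) m i j (a b : int) :
    (0 < n)%N -> (forall i j, #|color_class c i| = #|color_class c j|) ->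
    pairing m -> 0 < a * deviation n c m i + b * deviation n c m j ->
  exists u v, switchable m u v /\ a * gain c m u v i + b * gain c m u v j < 0.
Proof.
move=> n0 bal pm pos.
have : \sum_u \sum_(v | switchable m u v)
    (a * gain c m u v i + b * gain c m u v j) < 0.
  under eq_bigr do rewrite big_split -!mulr_sumr /=.
  rewrite big_split -!mulr_sumr /= !sum_gain //; nia.
rewrite ltNge => /negP h.
case: (boolP [exists u, [exists v, switchable m u v &&
    (a * gain c m u v i + b * gain c m u v j < 0)]]).
  by case/existsP => u /existsP[v /andP[? ?]]; exists u, v.
move=> /existsPn hn; case: h; apply: sumr_ge0 => u _; apply: sumr_ge0 => v suv.
by move: (hn u) => /existsPn/(_ v); rewrite suv -leNgt.
Qed.

(** * Interaction of two switches, and bounds on gains *)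

(** The first switch changes the pairing only on [A], so for [u] and [v] outside [A] the same four
    edges are exchanged before and after it. *)
Lemma switch_cases (V : finType) (c : {set V} -> 'I_3) m u0 v0 u v :
    pairing m -> switchable m u v ->
  let A := [:: u0; m u0; v0; m v0] in
  [\/ switchable (switch m u0 v0) u v /\
      gain c (switch m u0 v0) u v =1 gain c m u v, u \in A | v \in A].
Proof.
move=> pm suv A.
case: (boolP (u \in A)) => [|uN]; first by constructor 2.
case: (boolP (v \in A)) => [|vN]; first by constructor 3.
constructor 1; split=> [|i]; first by rewrite /switchable switch_id.
by rewrite /gain !switch_id.
Qed.

Lemma switched_color (V : finType) (c : {set V} -> 'I_3) m u0 v0 x :
    pairing m -> x \in [:: u0; m u0; v0; m v0] ->
  c [set x; m x] = c [set u0; m u0] \/ c [set x; m x] = c [set v0; m v0].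
Proof.
move=> pm; rewrite !inE => /or4P[] /eqP->; rewrite ?pairingK //; first by left.
- by left; rewrite setUC.
- by right.
- by right; rewrite setUC.
Qed.

Lemma color_exists (i j k : 'I_3) (P : 'I_3 -> Prop) :
  uniq [:: i; j; k] -> (exists x, P x) -> P i \/ P j \/ P k.
Proof.
move=> ijk [x]; have [_ _ _] := ind_color ijk x.
case: (x =P i) => [->|_]; first by auto.
case: (x =P j) => [->|_]; first by auto.
by case: (x =P k) => [->|_] //; auto.
Qed.

Lemma gain_bound (V : finType) (c : {set V} -> 'I_3) (m : {perm V}) u v i :
  - 2 <= gain c m u v i <= 2.
Proof. by rewrite /gain; do 4!case: (_ == i). Qed.

Lemma sum_gain_color (V : finType) (c : {set V} -> 'I_3) (m : {perm V}) u v i j k :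
    uniq [:: i; j; k] ->
  gain c m u v i + gain c m u v j + gain c m u v k = 0.
Proof.
move=> ijk.
have tot x : (x == i)%:Z + (x == j)%:Z + (x == k)%:Z = 1.
  by case: (ind_color ijk x).
rewrite /gain; have := tot (c [set u; m u]); have := tot (c [set v; m v]).
have := tot (c [set u; v]); have := tot (c [set m u; m v]).
lra.
Qed.

Lemma gain_ge (V : finType) (c : {set V} -> 'I_3) (m : {perm V}) u v i :
  c [set u; m u] != i \/ c [set v; m v] != i -> - 1 <= gain c m u v i.
Proof. by rewrite /gain; do 4!case: (_ == i) => //; case. Qed.

Lemma gain_eqN2 (V : finType) (c : {set V} -> 'I_3) (m : {perm V}) u v i :
  gain c m u v i = - 2 -> c [set u; m u] = i /\ c [set v; m v] = i.
Proof.
by rewrite /gain; do 4!case: (_ =P i) => ? //.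
Qed.

Lemma gain_le (V : finType) (c : {set V} -> 'I_3) (m : {perm V}) u v i :
  c [set u; m u] = i \/ c [set v; m v] = i -> gain c m u v i <= 1.
Proof. by rewrite /gain => -[] ->; rewrite eqxx; do 3!case: (_ == i). Qed.

Lemma gain_ge0 (V : finType) (c : {set V} -> 'I_3) (m : {perm V}) u v i :
  c [set u; m u] != i -> c [set v; m v] != i -> 0 <= gain c m u v i.
Proof. by rewrite /gain; do 4!case: (_ == i). Qed.

Lemma gain_eq2 (V : finType) (c : {set V} -> 'I_3) (m : {perm V}) u v i :
  gain c m u v i = 2 -> c [set u; m u] != i /\ c [set v; m v] != i.
Proof. by rewrite /gain; do 4!case: (_ == i). Qed.

(** * Reaching a matching without zero deviation *)

(* Only switches changing s * d by a vector with k-th entry -2 could raise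
   s * d_j at m.  None of these remains admissible after the given switch, and
   none of them uses an edge removed by that switch. *)
Lemma zero_deviation_case (n : nat) (c : {set 'I_(6 * n)} -> 'I_3) m i j k
    (s : int) u0 v0 :
    (0 < n)%N -> (forall i j, #|color_class c i| = #|color_class c j|) ->
    (forall m, pairing m -> exists i, 2 <= `|deviation n c m i|) ->
    (forall m, pairing m ->
      exists i, 3 <= `|deviation n c m i| \/ deviation n c m i = 0) ->
    uniq [:: i; j; k] -> pairing m -> s = 1 \/ s = - 1 ->
    switchable m u0 v0 ->
    s * deviation n c m i = 2 -> s * deviation n c m j = - 2 ->
    s * gain c m u0 v0 i = - 2 -> s * gain c m u0 v0 j = 0 ->
  False.
Proof.
move=> n0 bal Hmin Hzero ijk pm s1 s0 di dj gi gj.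
have dk := sum_deviation c ijk pm.
have gk := sum_gain_color c m u0 v0 ijk.
have [|u [v [suv]]] := @exists_gain n c m j j (- s) 0 n0 bal pm; first by nia.
rewrite mul0r addr0 => gpos.
have Huv := color_exists ijk (Hmin _ (pairing_conj (tperm (m u) v) pm)).
have Zuv := color_exists ijk (Hzero _ (pairing_conj (tperm (m u) v) pm)).
rewrite -/(switch m u v) !deviation_switch // in Huv Zuv.
have gs := sum_gain_color c m u v ijk.
have [bi bj bk] := And3 (gain_bound c m u v i) (gain_bound c m u v j) (gain_bound c m u v k).
(* [Hmin] and [Hzero] leave only (1, 1, -2) and (0, 2, -2) for [s] times the gains. *)
have egk : s * gain c m u v k = - 2.
  move: (deviation n c m i) (deviation n c m j) (deviation n c m k) dk di dj Huv Zuv => d1 d2 d3.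
  move: (gain c m u v i) (gain c m u v j) (gain c m u v k) gs bi bj bk gpos => e1 e2 e3.
  by clear -s1; case: s1 => ->; rewrite ?mulNr ?mul1r; lia.
clear Huv Zuv.
have old : (exists x, (x \in [:: u0; m u0; v0; m v0]) /\ (x = u \/ x = v)) -> False.
  case=> x [xA xuv].
  have ik : i != k by move: ijk; rewrite /= !inE negb_or => /andP[/andP[]].
  (* For [s = 1] both removed edges have colour [i], so gain -2 in [k] is impossible at them; for
     [s = - 1] both have colour [k], so gain 2 in [k] is impossible. *)
  case: s1 => es; rewrite es in di dj gi gj gpos egk.
    have [p q] : c [set u0; m u0] = i /\ c [set v0; m v0] = i by apply: gain_eqN2; lia.
    have cx : c [set x; m x] = i by have [] := switched_color c pm xA; rewrite ?p ?q.
    have: - 1 <= gain c m u v k by apply: gain_ge; case: xuv => <-; rewrite cx; auto.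
    lia.
  have [p q] : c [set u0; m u0] = k /\ c [set v0; m v0] = k by apply: gain_eqN2; lia.
  have cx : c [set x; m x] = k by have [] := switched_color c pm xA; rewrite ?p ?q.
  have: gain c m u v k <= 1 by apply: gain_le; case: xuv => <-; rewrite cx; auto.
  lia.
case: (switch_cases c u0 v0 pm suv) => [[suv' geq]|uA|vA]; last 2 first.
- by apply: old; exists u; auto.
- by apply: old; exists v; auto.
(* The first switch leads to (0, -2, 2) up to the sign [s]; the second then yields (1, -1, 0) or (0,
   0, 0), against [Hmin]. *)
have pm' : pairing (switch m u0 v0) by apply: pairing_conj.
have := color_exists ijk (Hzero _ (pairing_conj (tperm (switch m u0 v0 u) v) pm')).
have := color_exists ijk (Hmin _ (pairing_conj (tperm (switch m u0 v0 u) v) pm')).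
rewrite -/(switch (switch m u0 v0) u v) !(@deviation_switch _ _ _ (switch m u0 v0)) //.
rewrite !(@deviation_switch _ _ _ m u0 v0) // !geq {geq}.
clear Hmin Hzero old.
move: (deviation n c m i) (deviation n c m j) (deviation n c m k) dk di dj => d1 d2 d3.
move: (gain c m u v i) (gain c m u v j) (gain c m u v k) gs bi bj bk gpos egk => e1 e2 e3.
move: (gain c m u0 v0 i) (gain c m u0 v0 j) (gain c m u0 v0 k) gk gi gj => f1 f2 f3.
by case: s1 => ->; rewrite ?mulNr ?mul1r; lia.
Qed.

Lemma third_color (i k : 'I_3) : i != k -> exists j, uniq [:: i; j; k].
Proof.
by case: i k => [[|[|[]]] // ?] [[|[|[]]] // ?] ik;
  [exists (inord 2) | exists (inord 1) | exists (inord 2) | exists (inord 0)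
    | exists (inord 1) | exists (inord 0)];
  rewrite /= !inE -!val_eqE /= !inordK.
Qed.

Lemma exists_sign (x t : int) : `|x| = t -> exists2 s : int, s = 1 \/ s = - 1 & s * x = t.
Proof.
have [x0|x0] := leP 0 x => <-; [exists 1 | exists (- 1)]; auto; lia.
Qed.

(** Otherwise [m0] has deviations (t, -t, 0) up to sign and order, and decreasing the difference of
    the first two forces [zero_deviation_case]. *)
Lemma exists_nonzero_deviation (n : nat) (c : {set 'I_(6 * n)} -> 'I_3)
    (t : int) m0 :
    (0 < n)%N -> (forall i j, #|color_class c i| = #|color_class c j|) ->
    2 <= t ->
    (forall m, pairing m -> exists i, t <= `|deviation n c m i|) ->
    pairing m0 -> (forall i, `|deviation n c m0 i| <= t) ->
  exists m, pairing m /\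
    forall i, `|deviation n c m i| <= t /\ deviation n c m i != 0.
Proof.
move=> n0 bal t2 Hmin pm0 max0.
case: (boolP [exists m, pairing m && [forall i, (`|deviation n c m i| <= t) &&
    (deviation n c m i != 0)]]).
  by case/existsP => m /andP[pm /forallP h]; exists m; split=> // i; apply/andP.
move=> /existsPn none.
have Hzero m : pairing m ->
    exists i, t + 1 <= `|deviation n c m i| \/ deviation n c m i = 0.
  move=> pm; move: (none m); rewrite pm /= => /forallPn[i].
  rewrite negb_and -ltNge negbK => /orP h; exists i.
  by case: h => [|/eqP]; [left; lia | right].
exfalso.
have [i ti] := Hmin _ pm0.
have [k zk] := Hzero _ pm0.
have {}zk : deviation n c m0 k = 0 by case: zk; have := max0 k; lia.
have ik : i != k by apply: contraTneq ti => ->; lia.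
have [j ijk] := third_color ik.
have [|s s1 di] := @exists_sign (deviation n c m0 i) t; first by have := max0 i; lia.
have dk := sum_deviation c ijk pm0.
have dj : s * deviation n c m0 j = - t by nia.
have [|u [v [suv gneg]]] := @exists_gain n c m0 i j s (- s) n0 bal pm0.
  by rewrite mulNr di dj; lia.
have Huv := color_exists ijk (Hmin _ (pairing_conj (tperm (m0 u) v) pm0)).
have Zuv := color_exists ijk (Hzero _ (pairing_conj (tperm (m0 u) v) pm0)).
rewrite -/(switch m0 u v) !deviation_switch // in Huv Zuv.
have gs := sum_gain_color c m0 u v ijk.
have [bi bj bk] := And3 (gain_bound c m0 u v i) (gain_bound c m0 u v j) (gain_bound c m0 u v k).
(* A new zero without an entry beyond [t] requires an entry [t - 2] or [2 - t] to vanish, hence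
   [t = 2]. *)
have [te [[gi gj]|[gi gj]]] : t = 2 /\
    ((s * gain c m0 u v i = - 2 /\ s * gain c m0 u v j = 0) \/
     (s * gain c m0 u v i = 0 /\ s * gain c m0 u v j = 2)).
- move: (deviation n c m0 i) (deviation n c m0 j) (deviation n c m0 k) dk di dj zk Huv Zuv => d1 d2 d3.
  move: (gain c m0 u v i) (gain c m0 u v j) (gain c m0 u v k) gs bi bj bk gneg => e1 e2 e3.
  by clear -s1 t2; case: s1 => ->; rewrite ?mulNr ?mul1r; lia.
- move: Hmin Hzero; rewrite te in di dj * => Hmin Hzero.
  exact: (zero_deviation_case n0 bal Hmin Hzero ijk pm0 s1 suv di dj gi gj).
(* The second case becomes the first on exchanging [i] with [j] and negating [s]. *)
- have jik : uniq [:: j; i; k].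
    by rewrite (perm_uniq (_ : perm_eq _ [:: i; j; k])) // (perm_catCA [:: j] [:: i] [:: k]).
  move: Hmin Hzero; rewrite te in di dj * => Hmin Hzero.
  apply: (zero_deviation_case n0 bal Hmin Hzero jik pm0 (s := - s) _ suv).
  + by case: s1 => ->; auto.
  + by rewrite mulNr dj.
  + by rewrite mulNr di.
  + by rewrite mulNr gj.
  + by rewrite mulNr gi.
Qed.

(** * The corner switch and its impossibility *)

Lemma exists_corner_switch (n : nat) (c : {set 'I_(6 * n)} -> 'I_3)
    (t : int) m :
    (0 < n)%N -> (forall i j, #|color_class c i| = #|color_class c j|) ->
    2 <= t ->
    (forall m, pairing m -> exists i, t <= `|deviation n c m i|) ->
    pairing m ->
    (forall i, `|deviation n c m i| <= t /\ deviation n c m i != 0) ->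
  exists m u v i j k, [/\ pairing m, switchable m u v, uniq [:: i; j; k],
    [/\ deviation n c m i = t, deviation n c m j = 1 - t &
      deviation n c m k = - 1]
    & [/\ gain c m u v i = - 1, gain c m u v j = - 1 & gain c m u v k = 2]].
Proof.
move=> n0 bal t2 Hmin pm nz.
have [i ti] := Hmin _ pm.
have [|s s1 di] := @exists_sign (deviation n c m i) t; first by have [] := nz i; lia.
have [|u [v [suv gneg]]] := @exists_gain n c m i i s 0 n0 bal pm.
  by rewrite di; lia.
have key j k : uniq [:: i; j; k] -> s * deviation n c m k = - 1 ->
    s * gain c m u v i = - 1 -> s * gain c m u v j = - 1 ->
  exists m u v i j k, [/\ pairing m, switchable m u v, uniq [:: i; j; k],
    [/\ deviation n c m i = t, deviation n c m j = 1 - t &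
      deviation n c m k = - 1]
    & [/\ gain c m u v i = - 1, gain c m u v j = - 1 & gain c m u v k = 2]].
  move=> ijk dk gi gj.
  have ds := sum_deviation c ijk pm; have gs := sum_gain_color c m u v ijk.
  case: s1 => es; rewrite es ?mulN1r ?mul1r in di dk gi gj.
    exists m, u, v, i, j, k; split=> //.
      by clear -di dk ds; split; lia.
    by clear -gi gj gs; split; lia.
  (* For s = -1, the inverse switch has the required form. *)
  have rev x : gain c (switch m u v) u (m u) x = - gain c m u v x.
    have := @deviation_switch _ n c _ _ _ x (pairing_conj (tperm (m u) v) pm)
      (switchableK pm suv).
    by rewrite -/(switch m u v) switchK // deviation_switch //; lia.
  exists (switch m u v), u, (m u), j, i, k; split.
  - exact: pairing_conj.
  - exact: switchableK.
  - by rewrite (perm_uniq (_ : perm_eq _ [:: i; j; k])) // (perm_catCA [:: j] [:: i] [:: k]).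
  - by rewrite !deviation_switch //; clear -di dk ds gi gj gs; split; lia.
  - by rewrite !rev; clear -gi gj gs; split; lia.
have [k ik] : exists k, i != k.
  by case: (eqVneq i ord0) => [->|]; [exists ord_max | exists ord0].
have [j ijk] := third_color ik.
have ikj : uniq [:: i; k; j].
  by rewrite (perm_uniq (_ : perm_eq _ [:: i; j; k])) // perm_cons (perm_catC [:: k] [:: j]).
have Huv := color_exists ijk (Hmin _ (pairing_conj (tperm (m u) v) pm)).
rewrite -/(switch m u v) !deviation_switch // in Huv.
have ds := sum_deviation c ijk pm.
have gs := sum_gain_color c m u v ijk.
have [[mj zj] [mk zk]] := (nz j, nz k).
have [bi bj bk] := And3 (gain_bound c m u v i) (gain_bound c m u v j) (gain_bound c m u v k).
(* Up to [s], the other two deviations lie between 1 - t and -1. Once the [i]-th entry drops, one of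
   them must reach -t, and the zero sum of gains leaves only a gain of -1 there. *)
have : s * gain c m u v i = - 1 /\
  ((s * deviation n c m k = - 1 /\ s * gain c m u v j = - 1) \/
   (s * deviation n c m j = - 1 /\ s * gain c m u v k = - 1)).
  move: (deviation n c m i) (deviation n c m j) (deviation n c m k) ds di mj zj mk zk Huv => d1 d2 d3.
  move: (gain c m u v i) (gain c m u v j) (gain c m u v k) gs bi bj bk gneg => e1 e2 e3.
  by clear -s1 t2; case: s1 => ->; rewrite mul0r addr0 ?mulNr ?mul1r; lia.
by case=> gi [[dk gj]|[dj gk]]; [apply: (key j k) | apply: (key k j)].
Qed.

(** Each loss in the [i] minus [j] gain is charged to a vertex of [A] and an end of a [k]-coloured
    edge of [m]. *)
Lemma no_corner_switch (n : nat) (c : {set 'I_(6 * n)} -> 'I_3)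
    (t : int) m u0 v0 i j k :
    (0 < n)%N -> (forall i j, #|color_class c i| = #|color_class c j|) ->
    2 <= t ->
    (forall m, pairing m -> exists i, t <= `|deviation n c m i|) ->
    pairing m -> switchable m u0 v0 -> uniq [:: i; j; k] ->
    deviation n c m i = t -> deviation n c m j = 1 - t ->
    deviation n c m k = - 1 ->
    gain c m u0 v0 i = - 1 -> gain c m u0 v0 j = - 1 ->
    gain c m u0 v0 k = 2 ->
  False.
Proof.
move=> n0 bal t2 Hmin pm s0 ijk di dj dk gi gj gk.
pose A := [:: u0; m u0; v0; m v0].
pose K x : int := (c [set x; m x] == k)%:Z.
have pm' : pairing (switch m u0 v0) by apply: pairing_conj.
(* A switch using an edge on A can lose 3 only if its other edge has colour k. *)
have low u v : switchable m u v ->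
    - 3 * ((u \in A)%:Z * K v + (v \in A)%:Z * K u) <=
    gain c m u v i - gain c m u v j.
  move=> suv.
  have Huv := color_exists ijk (Hmin _ (pairing_conj (tperm (m u) v) pm)).
  rewrite -/(switch m u v) !deviation_switch // di dj dk in Huv.
  have gs := sum_gain_color c m u v ijk.
  have [bi bj bk] := And3 (gain_bound c m u v i) (gain_bound c m u v j) (gain_bound c m u v k).
  have [K0u K0v] : 0 <= K u /\ 0 <= K v by [].
  have onA (p q : bool) : p || q -> (p -> K u = 0) -> (q -> K v = 0) ->
      - 3 * (p%:Z * K v + q%:Z * K u) <= gain c m u v i - gain c m u v j.
    move=> pq pu qv.
    have gN3 : - 3 <= gain c m u v i - gain c m u v j by clear -Huv gs bi bj bk t2; lia.
    have g0 : K u = 0 -> K v = 0 -> 0 <= gain c m u v i - gain c m u v j.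
      rewrite /K; case: eqP => // /eqP uk _; case: eqP => // /eqP vk _.
      by have := gain_ge0 uk vk; clear -Huv gs bi bj bk t2; lia.
    move: pq pu qv gN3 g0 K0u K0v; rewrite /K.
    by clear; case: p q (_ == k) (_ == k) => [] [] [] [] /=; lia.
  (* Gain 2 in [k] means that neither removed edge has colour [k]. *)
  have AK x : x \in A -> K x = 0.
    rewrite /K => xA; have [p q] := gain_eq2 gk.
    by have [->|->] := switched_color c pm xA; rewrite ?(negPf p) ?(negPf q).
  case: (boolP ((u \in A) || (v \in A))) => [uvA|].
    by apply: onA => // /AK.
  rewrite negb_or => /andP[uA vA].
  have [[suv' geq]|uA'|vA'] := switch_cases c u0 v0 pm suv; last 2 first.
  - by move: uA; rewrite /A uA'.
  - by move: vA; rewrite /A vA'.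
  (* Off [A], [Hmin] applies both from (t, 1 - t, -1) and from (t - 1, -t, 1); together they exclude
     every loss. *)
  have Huv' := color_exists ijk (Hmin _ (pairing_conj (tperm (switch m u0 v0 u) v) pm')).
  rewrite -/(switch (switch m u0 v0) u v) !(@deviation_switch _ _ _ (switch m u0 v0)) // in Huv'.
  rewrite !(@deviation_switch _ _ _ m u0 v0) // !geq di dj dk gi gj gk in Huv'.
  rewrite (negPf uA) (negPf vA) !mul0r addr0 mulr0.
  by clear -Huv Huv' gs bi bj bk t2; lia.
have sumA : \sum_u (u \in A)%:Z <= 4.
  have -> : \sum_u (u \in A)%:Z = #|A|%:Z.
    rewrite -sum1_card -natz natr_sum [RHS]big_mkcond.
    by apply: eq_bigr => x _; case: (x \in A).
  by have := card_size A; rewrite /=; lia.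
have sumK : \sum_x K x = 2 * (n%:Z - 1).
  rewrite /K card_color_pairing_sum //; move: dk; rewrite /deviation; lia.
have : \sum_u \sum_(v | switchable m u v)
      - 3 * ((u \in A)%:Z * K v + (v \in A)%:Z * K u) <=
    \sum_u \sum_(v | switchable m u v) (gain c m u v i - gain c m u v j).
  by apply: ler_sum => u _; apply: ler_sum => v; apply: low.
have -> : \sum_u \sum_(v | switchable m u v) (gain c m u v i - gain c m u v j)
    = - (4 * (6 * n%:Z - 1)) * (2 * t - 1).
  under eq_bigr do rewrite sumrB.
  by rewrite sumrB !sum_gain // di dj; ring.
have : - 3 * (\sum_u \sum_v ((u \in A)%:Z * K v + (v \in A)%:Z * K u)) <=
    \sum_u \sum_(v | switchable m u v)
      - 3 * ((u \in A)%:Z * K v + (v \in A)%:Z * K u).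
  rewrite mulr_sumr; apply: ler_sum => u _.
  rewrite mulr_sumr [leLHS](bigID (switchable m u)) /= gerDl.
  by apply: sumr_le0 => v _; rewrite mulNr oppr_le0 mulr_ge0 // addr_ge0 // mulr_ge0.
have -> : \sum_u \sum_v ((u \in A)%:Z * K v + (v \in A)%:Z * K u) =
    2 * ((\sum_u (u \in A)%:Z) * \sum_x K x).
  under eq_bigr do rewrite big_split /= -mulr_sumr -mulr_suml.
  by rewrite big_split /= -mulr_suml -mulr_sumr; ring.
rewrite sumK; move: (\sum_u (u \in A)%:Z) sumA => a a4.
(* The losses total at most 48(n - 1), but since 2t - 1 is at least 3 they would have to reach 12(6n
   - 1). *)
set X := \sum_u _; nia.
Qed.

(** * Conclusion from a matching of least maximal deviation *)

(** Order reversal has no fixpoint because 6n is even. *)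
Lemma exists_pairing n : exists m : {perm 'I_(6 * n)}, pairing m.
Proof.
exists (perm (@rev_ord_inj (6 * n))); apply/forallP => x.
rewrite !permE rev_ordK eqxx /= -val_eqE /=; have := ltn_ord x; lia.
Qed.

Theorem theorem3 (n : nat) (n_gt0 : (0 < n)%N)
    (c : {set 'I_(6 * n)} -> 'I_3)
    (c_balanced : forall i j : 'I_3, #|color_class c i| = #|color_class c j|) :
  exists M : {set {set 'I_(6 * n)}},
    perfect_matching M /\ matching_deviation c M <= 2%:Z.
Proof.
pose h (m : {perm 'I_(6 * n)}) : nat := \max_i `|deviation n c m i|%N.
have [m0 pm0] := exists_pairing n.
case: (arg_minnP h pm0) => m pm minm.
exists (pairing_edges m); split; first exact: perfect_matching_pairing.
have maxm i : `|deviation n c m i| <= (h m)%:Z.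
  by rewrite -abszE lez_nat; apply: (leq_bigmax_cond (F := fun i => `|deviation n c m i|%N)).
have [h2|h1] := leqP 2 (h m).
  have Hmin m' : pairing m' -> exists i, (h m)%:Z <= `|deviation n c m' i|.
    move=> /minm; rewrite {2}/h.
    have [|i _ ->] := eq_bigmax_cond (fun i => `|deviation n c m' i|%N) (A := 'I_3).
      by rewrite card_ord.
    by exists i; rewrite -abszE lez_nat.
  have t2 : 2 <= (h m)%:Z by lia.
  have [m1 [pm1 nz]] := exists_nonzero_deviation n_gt0 c_balanced t2 Hmin pm maxm.
  have [m2 [u [v [i [j [k [pm2 suv ijk [di dj dk] [gi gj gk]]]]]]]] :=
    exists_corner_switch n_gt0 c_balanced t2 Hmin pm1 nz.
  by case: (no_corner_switch n_gt0 c_balanced t2 Hmin pm2 suv ijk di dj dk gi gj gk).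
(* Three integers of absolute value at most 1 with sum 0 cannot all be nonzero, so the bound is 2
   rather than 3. *)
rewrite /matching_deviation !big_ord_recl big_ord0 -!/(deviation n c m _).
have ijk : uniq [:: ord0 : 'I_3; lift ord0 ord0; lift ord0 (lift ord0 ord0)] by [].
have := sum_deviation c ijk pm.
have := maxm ord0; have := maxm (lift ord0 ord0).
have := maxm (lift ord0 (lift ord0 ord0)).
move: (deviation n c m ord0) (deviation n c m _) (deviation n c m _) => d1 d2 d3.
lia.
Qed.
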